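(* Let $\mu$ be a positive Borel measure on $\mathbb{C}$ with infinite support and finite moments, with moment matrix $\mathbf{M}=(c_{i,j})_{i,j\ge0}$, $c_{i,j}=\int z^i\bar z^j\,d\mu$, and assume $\lim_{n\to\infty} c_{n,n}^{1/(2n)}<\infty$. Let $\mathbf{M}'=(c_{i+1,j})_{i,j\ge0}$ be the infinite matrix obtained from $\mathbf{M}$ by removing its first row. Then $$\overline{\left\{\frac{v\mathbf{M}'v^*}{v\mathbf{M}v^*}: v\in c_{00}\setminus\{0\}\right\}}=\operatorname{Co}(\operatorname{supp}(\mu)).$$
   Context: $c_{00}$ is the space of complex row sequences with finitely many nonzero entries; $v^*$ denotes the conjugate transpose. $\operatorname{Co}(S)$ denotes the convex hull of $S\subset\mathbb{C}$. *)

(* Defs.v *)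
From HB Require Import structures.
From mathcomp Require Import all_boot all_order all_algebra.
From mathcomp Require Import all_classical all_reals all_analysis.
From mathcomp Require Import complex.
Set Implicit Arguments. Unset Strict Implicit. Unset Printing Implicit Defensive.
Import Order.TTheory GRing.Theory Num.Theory.
Import numFieldNormedType.Exports.
Local Open Scope ring_scope.
Local Open Scope classical_set_scope.
Local Open Scope complex_scope.

(* The complex plane C is R[i]; as a measurable space it is identified with
   R * R (product of Borel sigma-algebras = Borel sigma-algebra of R^2)
   through the map [toC]. *)
Definition toC {R : realType} (p : R * R) : R[i] := p.1 +i* p.2.

Definition cintegral {R : realType} (mu : {measure set (R * R)%type -> \bar R})
  (g : R * R -> R[i]) : R[i] :=
  (Rintegral mu setT (fun p => complex.Re (g p))) +i*
  (Rintegral mu setT (fun p => complex.Im (g p))).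

Definition moment {R : realType} (mu : {measure set (R * R)%type -> \bar R})
  (i j : nat) : R[i] :=
  cintegral mu (fun p => toC p ^+ i * (toC p)^* ^+ j).

Definition finite_moments {R : realType} (mu : {measure set (R * R)%type -> \bar R}) :=
  forall k : nat, mu.-integrable setT (fun p => (complex.Re (`|toC p| ^+ k))%:E).

Definition msupp {R : realType} (mu : {measure set (R * R)%type -> \bar R}) : set R[i] :=
  [set z | forall e : R, 0 < e -> (0 < mu [set p | (`|toC p - z| < e%:C)%R])%E].

Definition conv_hull {R : realType} (S : set R[i]) : set R[i] :=
  [set z | exists (n : nat) (w : 'I_n -> R) (x : 'I_n -> R[i]),
     (forall k, 0 <= w k) /\ \sum_(k < n) w k = 1 /\ (forall k, S (x k)) /\
     z = \sum_(k < n) (w k)%:C * x k].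

Definition qform {R : realType} (a : nat -> nat -> R[i]) (N : nat) (v : nat -> R[i]) : R[i] :=
  \sum_(i < N) \sum_(j < N) v i * a i j * (v j)^*.

Definition moment_num_range {R : realType} (mu : {measure set (R * R)%type -> \bar R})
  : set R[i] :=
  [set q | exists (N : nat) (v : nat -> R[i]),
     (forall k, (N <= k)%N -> v k = 0) /\ (exists k, v k != 0) /\
     q = qform (fun i j => moment mu i.+1 j) N v / qform (moment mu) N v].

(* Main.v *)
(* With [p] the polynomial with coefficients [v], the quotient of the statement
   is the mean <zp, p> / <p, p> of z for the probability density proportional
   to |p|^2. Convergence of the c_{n,n}^{1/(2n)} makes the support compact, and a
   mean over the support satisfies every affine inequality valid on the
   support, so it lies in the convex hull, which is closed.
   Conversely the set of these means is convex (Toeplitz-Hausdorff), so by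
   separation it suffices to see that, for every direction u and every z0 in the
   support, some mean is at least as far in the direction u as z0, up to epsilon.
   The powers of z - w do this when w = z0 - T u with T large: |z - w|^(2n)
   concentrates near the points of the support farthest from w. *)
Require Import Defs.
From HB Require Import structures.
From mathcomp Require Import all_boot all_order all_algebra.
From mathcomp Require Import all_classical all_reals all_analysis.
From mathcomp Require Import measurable_realfun.
From mathcomp Require Import complex.
From mathcomp Require Import ring lra.
Import Order.TTheory GRing.Theory Num.Theory.
Import numFieldNormedType.Exports.
Local Open Scope ring_scope.
Local Open Scope classical_set_scope.
Local Open Scope complex_scope.

Set Implicit Arguments.
Unset Strict Implicit.
Unset Printing Implicit Defensive.

(** * Convexity in the plane *)

(** Two separations of different kinds are needed. The set of means is not known to be closed, so a
    point off its closure is separated from it with an almost nearest point. A point off the convex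
    hull is separated with a true nearest point, supplied by compactness of the support; this does
    the work of the closedness of the hull. The powers concentrate as announced because, for w = z0
    - T u, |z - w|^2 = |z - z0|^2 + 2 T u.(z - z0) + T^2 |u|^2, where u.z is the real scalar product
    [dot u z] = Re(conj(u) z). The first term is bounded on the support, so for large T the order by
    distance from w is nearly the order in the direction u. Since z0 is in the support, the points
    near z0 carry positive mass, and their weight beats that of the points too far behind at an
    exponential rate. Distances enter through their squares [dot z z], which keeps the estimates
    polynomial. *)

Definition dot {R : realType} (u z : R[i]) : R :=
  complex.Re u * complex.Re z + complex.Im u * complex.Im z.

(** Let d0 be the infimum of |z - w|^2 and [k0] a point of [W] that almost reaches it. A step of
    size t from [k0] towards any k of [W] cannot bring the square below d0; expanding it bounds (z -
    k0).(k - k0) by d0 / 2, so u = z - k0 separates. *)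
Lemma sep_convex (R : realType) (W : set R[i]) (z : R[i]) (D e : R) :
  (exists w, W w) ->
  (forall x y t, 0 <= t <= 1 -> W x -> W y ->
     W ((1 - t)%:C * x + t%:C * y)) ->
  (forall w, W w -> dot w w <= D) ->
  0 < e -> (forall w, W w -> e <= dot (z - w) (z - w)) ->
  exists u d, 0 < d /\ forall w, W w -> d <= dot u (z - w).
Proof.
move=> [w0 Ww0] cvxW bndW e0 farW.
pose E := [set dot (z - w) (z - w) | w in W].
have infE : has_inf E.
  split; first by exists (dot (z - w0) (z - w0)), w0.
  by exists e => _ [w Ww <-]; exact: farW.
pose d0 := inf E.
have d0e : e <= d0.
  by apply: lb_le_inf; [exact: infE.1 | move=> _ [w Ww <-]; exact: farW].
have d0E w : W w -> d0 <= dot (z - w) (z - w).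
  by move=> Ww; apply: ge_inf; [exact: infE.2 | exists w].
have D0 : 0 <= D.
  by apply: le_trans (bndW _ Ww0); rewrite addr_ge0// -expr2 sqr_ge0.
(* [4 * D] bounds the squared diameter of [W], and [d0 + 1] ensures t <= 1. The choice of t makes
   the second-order term t^2 B equal to t d0 / 2, the excess also allowed to [k0]. *)
pose B := 4 * D + d0 + 1.
have B0 : 0 < B by rewrite /B; lra.
pose t := d0 / (2 * B).
have t0 : 0 < t by rewrite divr_gt0//; lra.
have tB : 2 * t * B = d0 by rewrite /t; field; lra.
have t1 : t <= 1 by rewrite ler_pdivrMr ?mulr_gt0//; rewrite /B; lra.
have eta0 : 0 < t * d0 / 2 by rewrite divr_gt0// mulr_gt0//; lra.
have [_ [k0 Wk0 <-] k0d] := inf_adherent eta0 infE.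
rewrite -/d0 in k0d.
exists (z - k0), (d0 / 2); split; first by lra.
move=> k Wk.
have diam : dot (k - k0) (k - k0) <= B.
  have /= h1 := bndW _ Wk; have /= h2 := bndW _ Wk0.
  rewrite /B; clear - h1 h2 d0e e0 D0; case: k k0 h1 h2 => [a b] [c d].
  rewrite /dot /= => h1 h2.
  have := sqr_ge0 (a + c); have := sqr_ge0 (b + d).
  by nra.
have := d0E _ (cvxW _ _ t _ Wk0 Wk).
rewrite (ltW t0) t1 => /(_ isT) dt.
have : dot (z - ((1 - t)%:C * k0 + t%:C * k)) (z - ((1 - t)%:C * k0 + t%:C * k))
  = dot (z - k0) (z - k0) - 2 * t * dot (z - k0) (k - k0)
    + t ^+ 2 * dot (k - k0) (k - k0).
  by case: (z) (k) (k0) => [? ?] [? ?] [? ?]; rewrite /dot /=; ring.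
move=> E1; rewrite E1 in dt.
have -> : dot (z - k0) (z - k)
   = dot (z - k0) (z - k0) - dot (z - k0) (k - k0).
  by case: (z) (k) (k0) => [? ?] [? ?] [? ?]; rewrite /dot /=; ring.
have k0D := d0E _ Wk0.
set X := dot (z - k0) (k - k0) in dt *.
have : 2 * t * X <= 2 * t * (d0 / 2).
  have : t ^+ 2 * dot (k - k0) (k - k0) <= t ^+ 2 * B by rewrite ler_pM2l// exprn_gt0.
  have -> : t ^+ 2 * B = t * d0 / 2 by rewrite -tB; field.
  by lra.
rewrite ler_pM2l; last by rewrite mulr_gt0.
by lra.
Qed.

(* Toeplitz-Hausdorff: after an affine change of [A] the two values are 0 and 1;
   a twist by [w] makes the form real on the real pencil [w f + t g], so
   that hitting a prescribed value amounts to a real quadratic equation in [t]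
   with nonpositive constant term. *)
Lemma toeplitz_hausdorff (R : realType) (V : lmodType R[i])
  (A B : V -> V -> R[i]) :
  (forall a x y z, A (a *: x + y) z = a * A x z + A y z) ->
  (forall a x y z, A z (a *: x + y) = a^*%C * A z x + A z y) ->
  (forall a x y z, B (a *: x + y) z = a * B x z + B y z) ->
  (forall x y, B y x = (B x y)^*%C) ->
  (forall x, x != 0 -> 0 < complex.Re (B x x)) ->
  forall f g (l : R), f != 0 -> g != 0 -> 0 <= l <= 1 ->
  exists2 h, h != 0 & A h h / B h h =
    (1 - l)%:C * (A f f / B f f) + l%:C * (A g g / B g g).
Proof.
move=> Al Ar Bl Bh Bpos f g l f0 g0 /andP[l0 l1].
have Br a x y z : B z (a *: x + y) = a^*%C * B z x + B z y.
  by rewrite Bh Bl rmorphD rmorphM /= -!Bh.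
have Bre x : B x x = (complex.Re (B x x))%:C.
  have := Bh x x; case: (B x x) => a b [] /= /eqP.
  by rewrite -addr_eq0 -mulr2n -mulr_natl mulf_eq0 pnatr_eq0 /= => /eqP ->.
have BxN0 x : x != 0 -> B x x != 0.
  by move=> /Bpos p; rewrite Bre; apply: contraTN p => /eqP [->]; rewrite ltxx.
set al := A f f / B f f; set be := A g g / B g g.
have [<-|alNbe] := eqVneq al be.
  exists f => //; rewrite -/al.
  by rewrite -mulrDl -rmorphD /= subrK mul1r.
(* Treated apart because the quadratic below has leading coefficient (1 - l) B(g, g). *)
have [->|lN1] := eqVneq l 1.
  by exists g; rewrite // subrr mul0r add0r mul1r.
have {lN1}l1 : l < 1 by rewrite lt_neqAle lN1.
have beal : be - al != 0 by rewrite subr_eq0 eq_sym.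
pose A' x y := (A x y - al * B x y) / (be - al).
have A'l a x y z : A' (a *: x + y) z = a * A' x z + A' y z.
  by rewrite /A' Al Bl; field.
have A'r a x y z : A' z (a *: x + y) = a^*%C * A' z x + A' z y.
  by rewrite /A' Ar Br; field.
have A'ff : A' f f = 0 by rewrite /A' /al divfK ?BxN0// subrr mul0r.
have A'gg : A' g g = B g g.
  rewrite /A' -[A g g](divfK (BxN0 _ g0)) -/be -mulrBl mulrAC divff// mul1r//.
suff [h h0 A'h] : exists2 h, h != 0 & A' h h = l%:C * B h h.
  exists h => //; apply: (canLR (mulfK (BxN0 _ h0))).
  have -> : A h h = (be - al) * A' h h + al * B h h by rewrite /A'; field.
  by rewrite A'h rmorphB /=; ring.
have [w w0 rw] : exists2 w : R[i], w != 0 &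
    complex.Im (w * A' f g + w^*%C * A' g f) = 0.
  (* The imaginary part to be killed equals Im(w c), so w = conj(c) works unless c = 0, when w = 1
     does. *)
  pose c := A' f g - (A' g f)^*%C.
  have [c0|cN0] := eqVneq c 0.
    exists 1; rewrite ?oner_eq0 //; rewrite conjc1 !mul1r; move: c0; rewrite /c.
    by case: (A' f g) (A' g f) => [a b] [a' b'] [] /= _ e; lra.
  exists c^*%C; first by rewrite conjc_eq0.
  by rewrite /c; case: (A' f g) (A' g f) => [a b] [a' b'] /=; ring.
pose G := complex.Re (B g g); pose F := complex.Re (B f f).
pose r := complex.Re (w * A' f g + w^*%C * A' g f).
pose c := complex.Re (w * B f g + w^*%C * B g f).
pose n := complex.Re (w * w^*%C).
have G0 : 0 < G := Bpos _ g0.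
have F0 : 0 < F := Bpos _ f0.
have n0 : 0 <= n.
  by rewrite /n; case: (w) => a b /=; rewrite mulrN opprK -!expr2 addr_ge0// sqr_ge0.
(* The left side is A'(h, h) - l B(h, h) at h = w f + t g. *)
have [t tE] : exists t : R, t ^+ 2 * ((1 - l) * G) + t * (r - l * c) - l * n * F = 0.
  have a0 : 0 < (1 - l) * G by rewrite mulr_gt0// subr_gt0.
  set a := (1 - l) * G in a0 *; set b := r - l * c.
  have q0 : 0 <= l * n * F by rewrite !mulr_ge0// ltW.
  set q := l * n * F in q0 *.
  have disc : 0 <= b ^+ 2 + 4 * a * q.
    by rewrite addr_ge0 ?sqr_ge0// mulr_ge0// mulr_ge0// ltW.
  exists ((Num.sqrt (b ^+ 2 + 4 * a * q) - b) / (2 * a)).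
  have := sqr_sqrtr disc; set s := Num.sqrt _ => sE.
  have -> : ((s - b) / (2 * a)) ^+ 2 * a + (s - b) / (2 * a) * b - q =
    (s ^+ 2 - (b ^+ 2 + 4 * a * q)) / (4 * a) by field; rewrite gt_eqF.
  by rewrite sE subrr mul0r.
pose h := w *: f + t%:C *: g.
have formE (Q : V -> V -> R[i]) :
    (forall a x y z, Q (a *: x + y) z = a * Q x z + Q y z) ->
    (forall a x y z, Q z (a *: x + y) = a^*%C * Q z x + Q z y) ->
    Q h h = w * w^*%C * Q f f + t%:C * (w * Q f g + w^*%C * Q g f)
      + t%:C ^+ 2 * Q g g.
  move=> Ql Qr.
  have Q0l x : Q 0 x = 0.
    by have := Ql 1 0 0 x; rewrite scaler0 addr0 mul1r -{1}[Q 0 x]addr0 => /addrI.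
  have Q0r x : Q x 0 = 0.
    by have := Qr 1 0 0 x; rewrite scaler0 addr0 conjc1 mul1r -{1}[Q x 0]addr0 => /addrI.
  have QZl a x y : Q (a *: x) y = a * Q x y by rewrite -[a *: x]addr0 Ql Q0l addr0.
  have QZr a x y : Q y (a *: x) = a^*%C * Q y x by rewrite -[a *: x]addr0 Qr Q0r addr0.
  by rewrite /h Ql !Qr !QZl !QZr conjc_real; ring.
have A'hE := formE A' A'l A'r.
have BhE := formE B Bl Br.
exists h.
  (* If h vanished, f would be a nonzero multiple of g, and A'(f, f) a nonzero multiple of B(g, g),
     although it is 0. *)
  apply/eqP => h0.
  have : A' f f != 0; last by rewrite A'ff eqxx.
  have fE : f = (- (t%:C / w)) *: g + 0.
    apply: (scalerI w0); rewrite addr0 scalerA mulrN mulrCA divff// mulr1 scaleNr.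
    by apply/eqP; rewrite -addr_eq0 -/h h0.
  have tw : - (t%:C / w) != 0.
    by apply: contraNneq f0 => tw; rewrite fE tw scale0r addr0.
  have A'g0 : A' g 0 = 0.
    by have := A'r 1 0 0 g; rewrite scaler0 addr0 conjc1 mul1r -{1}[A' g 0]addr0 => /addrI.
  have A'0f x : A' 0 x = 0.
    by have := A'l 1 0 0 x; rewrite scaler0 addr0 mul1r -{1}[A' 0 x]addr0 => /addrI.
  rewrite fE A'l A'0f addr0 A'r A'g0 addr0 A'gg.
  by rewrite !mulf_neq0// ?conjc_eq0// BxN0.
rewrite A'hE BhE A'ff A'gg mulr0 add0r.
have -> : w * A' f g + w^*%C * A' g f = r%:C.
  by rewrite /r; move: rw; case: (_ + _) => x y /= ->.
have -> : w * B f g + w^*%C * B g f = c%:C.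
  rewrite /c [B g f]Bh -rmorphM; case: (w * _) => x y /=.
  by apply/eqP; rewrite eq_complex /= subrr !eqxx.
have -> : w * w^*%C = n%:C.
  rewrite /n; case: (w) => x y; apply/eqP; rewrite eq_complex /=.
  by apply/andP; split => //; apply/eqP; ring.
rewrite [B g g]Bre [B f f]Bre -/G -/F -!(rmorphM, rmorphD, rmorphXn) /=.
by congr (_ %:C); apply/eqP; rewrite -subr_eq0 -tE; apply/eqP; ring.
Qed.

(** Nested segments replace barycentric weights so that the parameters range over the square
    [0, 1]^2, a product of compact intervals. *)
Definition triangle_point {R : realType} (s t : R) (x y z : R[i]) : R[i] :=
  (1 - s)%:C * x + s%:C * ((1 - t)%:C * y + t%:C * z).

Lemma triangle_point_barycentric (R : realType) (w0 w1 w2 : R) (x y z : R[i]) :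
  0 <= w0 -> 0 <= w1 -> 0 <= w2 -> w0 + w1 + w2 = 1 ->
  exists s t, [/\ 0 <= s <= 1, 0 <= t <= 1 &
    w0%:C * x + w1%:C * y + w2%:C * z = triangle_point s t x y z].
Proof.
move=> w00 w10 w20 w1E; have [s0|sN0] := eqVneq (w1 + w2) 0.
  exists 0, 0; split; rewrite ?lexx ?ler01//.
  have [-> -> ->] : [/\ w0 = 1, w1 = 0 & w2 = 0] by split; lra.
  by case: x y z => [? ?] [? ?] [? ?]; apply/eqP; rewrite eq_complex /=;
     apply/andP; split; apply/eqP; ring.
have s0 : 0 < w1 + w2 by rewrite lt0r sN0 addr_ge0.
exists (w1 + w2), (w2 / (w1 + w2)); split; first by apply/andP; split; lra.
  by rewrite divr_ge0 ?(ltW s0)//= ler_pdivrMr// mul1r; lra.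
have -> : w0 = 1 - w1 - w2 by lra.
by case: x y z => [? ?] [? ?] [? ?]; apply/eqP; rewrite eq_complex /=;
   apply/andP; split; apply/eqP; field.
Qed.

Lemma conv_hull_triangle (R : realType) (S : set R[i]) (s t : R) (x y z : R[i]) :
  S x -> S y -> S z -> 0 <= s <= 1 -> 0 <= t <= 1 ->
  conv_hull S (triangle_point s t x y z).
Proof.
move=> Sx Sy Sz /andP[s0 s1] /andP[t0 t1].
exists 3, (fun i => nth 0 [:: 1 - s; s * (1 - t); s * t] i),
  (fun i => nth 0 [:: x; y; z] i); split.
  by case=> [[|[|[|]]]] //= _; rewrite ?mulr_ge0// subr_ge0.
split; first by rewrite !big_ord_recl big_ord0 /=; ring.
split; first by case=> [[|[|[|]]]].
rewrite !big_ord_recl big_ord0 /= /triangle_point.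
by case: x y z {Sx Sy Sz} => [? ?] [? ?] [? ?]; apply/eqP; rewrite eq_complex /=;
   apply/andP; split; apply/eqP; ring.
Qed.

(** Limiting the combinations to three points gives a fixed compact parameter space [0, 1]^2 x S^3,
    on which the squared distance to z is continuous and attains its minimum. *)
Lemma triangle_point_nearest (R : realType) (S : set R[i]) (z : R[i]) :
  compact (toC @^-1` S) -> S !=set0 ->
  exists s t x y v, [/\ 0 <= s <= 1, 0 <= t <= 1, S x /\ S y /\ S v &
    forall s' t' x' y' v', 0 <= s' <= 1 -> 0 <= t' <= 1 ->
      S x' -> S y' -> S v' ->
      dot (triangle_point s t x y v - z) (triangle_point s t x y v - z) <=
      dot (triangle_point s' t' x' y' v' - z) (triangle_point s' t' x' y' v' - z)].
Proof.
move=> cS [x0 Sx0]; set S' := toC @^-1` S.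
pose K := (`[0, 1]%classic `*` `[0, 1]%classic) `*` (S' `*` (S' `*` S'))
  : set ((R * R) * ((R * R) * ((R * R) * (R * R)))).
have cK : compact K by do !apply: compact_setX => //; exact: segment_compact.
pose f (q : (R * R) * ((R * R) * ((R * R) * (R * R)))) :=
  let k := triangle_point q.1.1 q.1.2 (toC q.2.1) (toC q.2.2.1) (toC q.2.2.2) - z in
  dot k k.
have S'E w : S w -> S' (complex.Re w, complex.Im w) by case: w.
have K0 : K !=set0.
  exists ((0, 0), ((complex.Re x0, complex.Im x0), ((complex.Re x0, complex.Im x0),
    (complex.Re x0, complex.Im x0)))).
  by split; [split; rewrite /= in_itv /= lexx ler01 | split; [|split]; exact: S'E].
have cf : continuous f.
  pose bary (s t x y v : R) := (1 - s) * x + s * ((1 - t) * y + t * v).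
  have fE : f = fun q =>
      (bary q.1.1 q.1.2 q.2.1.1 q.2.2.1.1 q.2.2.2.1 - complex.Re z) ^+ 2 +
      (bary q.1.1 q.1.2 q.2.1.2 q.2.2.1.2 q.2.2.2.2 - complex.Im z) ^+ 2.
    apply/funext => -[[s t] [[x1 x2] [[y1 y2] [v1 v2]]]].
    by rewrite /f /bary /dot /triangle_point /toC /=; case: (z) => a b /=; ring.
  pose T := ((R * R) * ((R * R) * ((R * R) * (R * R))))%type.
  have cB (g h : T -> R) : continuous g -> continuous h ->
      continuous (fun q => g q - h q).
    by move=> cg ch q; exact: cvgB (cg q) (ch q).
  have cD (g h : T -> R) : continuous g -> continuous h ->
      continuous (fun q => g q + h q).
    by move=> cg ch q; exact: cvgD (cg q) (ch q).
  have cM (g h : T -> R) : continuous g -> continuous h ->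
      continuous (fun q => g q * h q).
    by move=> cg ch q; exact: cvgM (cg q) (ch q).
  have cC (a : R) : continuous (fun _ : T => a) by move=> q; exact: cvg_cst.
  have cbary (s t x y v : T -> R) : continuous s -> continuous t ->
      continuous x -> continuous y -> continuous v ->
      continuous (fun q => bary (s q) (t q) (x q) (y q) (v q)).
    move=> cs ct cx cy cv.
    exact: cD (cM _ _ (cB _ _ (cC 1) cs) cx)
      (cM _ _ cs (cD _ _ (cM _ _ (cB _ _ (cC 1) ct) cy) (cM _ _ ct cv))).
  have c1 (U V : topologicalType) (g : T -> U * V) :
      continuous g -> continuous (fun x => (g x).1).
    by move=> cg q; apply: (@cvg_comp _ _ _ g fst _ (nbhs (g q)));
       [exact: cg | exact: cvg_fst].
  have c2 (U V : topologicalType) (g : T -> U * V) :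
      continuous g -> continuous (fun x => (g x).2).
    by move=> cg q; apply: (@cvg_comp _ _ _ g snd _ (nbhs (g q)));
       [exact: cg | exact: cvg_snd].
  have ci : continuous (fun q : T => q) by move=> q; exact: cvg_id.
  have cl := c1 _ _ _ ci; have cr := c2 _ _ _ ci.
  have cx := c1 _ _ _ cr; have crr := c2 _ _ _ cr.
  have cy := c1 _ _ _ crr; have cv := c2 _ _ _ crr.
  have cs := c1 _ _ _ cl; have ct := c2 _ _ _ cl.
  have cre := cB _ _ (cbary _ _ _ _ _ cs ct (c1 _ _ _ cx) (c1 _ _ _ cy) (c1 _ _ _ cv))
    (cC (complex.Re z)).
  have cim := cB _ _ (cbary _ _ _ _ _ cs ct (c2 _ _ _ cx) (c2 _ _ _ cy) (c2 _ _ _ cv))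
    (cC (complex.Im z)).
  rewrite fE; exact: cD (cM _ _ cre cre) (cM _ _ cim cim).
have [q Kq fq] := compact_EVT_min K0 cK (continuous_subspaceT cf).
move: (set_mem Kq) => [[/= q11 q12] [q21 [q221 q222]]].
rewrite !in_itv in q11 q12.
exists q.1.1, q.1.2, (toC q.2.1), (toC q.2.2.1), (toC q.2.2.2); split => //.
move=> s' t' x' y' v' s'1 t'1 Sx' Sy' Sv'.
have := fq ((s', t'), ((complex.Re x', complex.Im x'), ((complex.Re y', complex.Im y'),
    (complex.Re v', complex.Im v')))).
rewrite /f /=; have toCE (w : R[i]) : toC (complex.Re w, complex.Im w) = w by case: w.
rewrite !toCE; apply; apply/mem_set.
by split; [split; rewrite /= in_itv | split; [|split]; exact: S'E].
Qed.

Lemma dot_ge0_first_order (R : realType) (u v : R[i]) :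
  (forall t : R, 0 < t <= 1 -> dot u u <= dot (u + t%:C * v) (u + t%:C * v)) ->
  0 <= dot u v.
Proof.
move=> H; rewrite leNgt; apply/negP => X0.
have Y0 : 0 <= dot v v by rewrite addr_ge0// -expr2 sqr_ge0.
set X := dot u v in X0 *; set Y := dot v v in Y0 *.
have YX : 0 < Y - X by lra.
(* The quadratic 2 t X + t^2 Y is least at - X / Y; the larger denominator keeps t at most 1 and
   covers Y = 0, and the value stays negative. *)
pose t := - X / (Y - X).
have t0 : 0 < t by rewrite divr_gt0// oppr_gt0.
have t1 : t <= 1 by rewrite ler_pdivrMr// mul1r; lra.
have := H t; rewrite t0 t1 => /(_ isT).
have -> : dot (u + t%:C * v) (u + t%:C * v) = dot u u + t * (2 * X + t * Y).
  by rewrite /X /Y; case: (u) (v) => [? ?] [? ?]; rewrite /dot /=; ring.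
have tE : t * (Y - X) = - X by rewrite divfK// gt_eqF.
have : t * Y <= - X by rewrite -tE ler_pM2l//; lra.
move=> h1 h2; have : t * (2 * X + t * Y) < 0 by rewrite pmulr_rlt0//; lra.
by lra.
Qed.

(** Serves to pick a vertex of positive weight on a prescribed closed side of a line through the
    weighted mean; the opposite side is obtained by changing signs. *)
Lemma weighted_mean0_ge0 (R : realType) (w0 w1 w2 s0 s1 s2 : R) :
  0 <= w0 -> 0 <= w1 -> 0 <= w2 -> w0 + w1 + w2 = 1 ->
  w0 * s0 + w1 * s1 + w2 * s2 = 0 ->
  [\/ 0 < w0 /\ 0 <= s0, 0 < w1 /\ 0 <= s1 | 0 < w2 /\ 0 <= s2].
Proof.
have aux (w s : R) : 0 <= w -> (0 < w /\ 0 <= s) \/ (w * s <= 0 /\ (w * s = 0 -> w = 0)).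
  rewrite le_eqVlt => /predU1P[<-|w_gt0]; first by right; rewrite mul0r.
  have [s_ge0|s_lt0] := leP 0 s; [by left|right].
  have ws : w * s < 0 by rewrite pmulr_rlt0.
  by split; [exact: ltW | move=> E; rewrite E ltxx in ws].
move=> w00 w10 w20 w1E sE.
have [?|[p0 z0]] := aux w0 s0 w00; first by constructor 1.
have [?|[p1 z1]] := aux w1 s1 w10; first by constructor 2.
have [?|[p2 z2]] := aux w2 s2 w20; first by constructor 3.
have := z0 ltac:(lra); have := z1 ltac:(lra); have := z2 ltac:(lra).
by lra.
Qed.

(* The point [k] of the triangles on [S] nearest to [z] lies on a segment with
   ends in [S]: the vertices of positive weight are on the line through [k]
   orthogonal to [k - z]. Hence joining [k] to any point of [S] stays within
   triangles on [S]; two-dimensionality of the plane replaces Caratheodory's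
   theorem. *)
Lemma sep_conv_hull (R : realType) (S : set R[i]) (z : R[i]) :
  compact (toC @^-1` S) -> S !=set0 -> ~ conv_hull S z ->
  exists u e, 0 < e /\ forall s, S s -> e <= dot u (s - z).
Proof.
move=> cS S0 Nz.
have [s [t [x0 [x1 [x2 [s01 t01 [Sx0 [Sx1 Sx2]] kmin]]]]]] :=
  triangle_point_nearest z cS S0.
pose k := triangle_point s t x0 x1 x2; rewrite -/k in kmin.
have Hk : conv_hull S k by exact: conv_hull_triangle.
exists (k - z), (dot (k - z) (k - z)).
have dot_gt0 (v : R[i]) : v != 0 -> 0 < dot v v.
  case: v => a b; rewrite eq_complex negb_and /dot /= -!expr2 => ab.
  rewrite lt0r addr_ge0 ?sqr_ge0// andbT paddr_eq0 ?sqr_ge0// !sqrf_eq0 negb_and.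
  exact: ab.
have u0 : 0 < dot (k - z) (k - z).
  by apply: dot_gt0; rewrite subr_eq0; apply: contra_not_neq Nz => <-.
split=> // y Sy.
suff : 0 <= dot (k - z) (y - k).
  move=> yk; have -> : dot (k - z) (y - z) = dot (k - z) (k - z) + dot (k - z) (y - k).
    by case: (k) (y) (z) => [? ?] [? ?] [? ?]; rewrite /dot /=; ring.
  by rewrite lerDl.
(* Minimality of k can be tested towards v as soon as the segment from k to v stays within triangles
   on S. *)
have seg v : (forall r : R, 0 < r <= 1 -> exists s t x y v', [/\ 0 <= s <= 1, 0 <= t <= 1,
    S x /\ S y /\ S v' & (1 - r)%:C * k + r%:C * v = triangle_point s t x y v']) ->
    0 <= dot (k - z) (v - k).
  move=> H; apply: dot_ge0_first_order => r r01.
  have [s' [t' [x' [y' [v' [s'1 t'1 [? [? ?]] E]]]]]] := H _ r01.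
  have -> : k - z + r%:C * (v - k) = (1 - r)%:C * k + r%:C * v - z.
    by rewrite rmorphB /=; ring.
  by rewrite E; exact: kmin.
case/andP: (s01) => s0 s1; case/andP: (t01) => t0 t1.
pose w0 := 1 - s; pose w1 := s * (1 - t); pose w2 := s * t.
have w00 : 0 <= w0 by rewrite subr_ge0.
have w10 : 0 <= w1 by rewrite mulr_ge0// subr_ge0.
have w20 : 0 <= w2 by rewrite mulr_ge0.
have wE : w0 + w1 + w2 = 1 by rewrite /w0 /w1 /w2; ring.
have kE : k = w0%:C * x0 + w1%:C * x1 + w2%:C * x2.
  by rewrite /k /triangle_point /w0 /w1 /w2 !(rmorphM, rmorphB) /=; ring.
have vertex (v0 v1 v2 : R) v : 0 <= v0 -> 0 <= v1 -> 0 <= v2 -> v0 + v1 + v2 = 1 ->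
    v = v0%:C * x0 + v1%:C * x1 + v2%:C * x2 -> 0 <= dot (k - z) (v - k).
  move=> v00 v10 v20 vE ->; apply: seg => r /andP[r0 r1].
  have cvx (a b : R) : 0 <= a -> 0 <= b -> 0 <= (1 - r) * a + r * b.
    by move=> a0 b0; rewrite addr_ge0 ?mulr_ge0 ?subr_ge0// ltW.
  have sum1 : ((1 - r) * w0 + r * v0) + ((1 - r) * w1 + r * v1)
      + ((1 - r) * w2 + r * v2) = 1.
    by transitivity ((1 - r) * (w0 + w1 + w2) + r * (v0 + v1 + v2));
      [ring | rewrite wE vE; ring].
  have [s' [t' [? ? E]]] := triangle_point_barycentric x0 x1 x2
    (cvx _ _ w00 v00) (cvx _ _ w10 v10) (cvx _ _ w20 v20) sum1.
  exists s', t', x0, x1, x2; split => //; rewrite -E kE.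
  by rewrite !(rmorphD, rmorphM, rmorphB) /=; ring.
have d0 : 0 <= dot (k - z) (x0 - k).
  by apply: (vertex 1 0 0); rewrite ?addr0//; ring.
have d1 : 0 <= dot (k - z) (x1 - k).
  by apply: (vertex 0 1 0); rewrite ?addr0 ?add0r//; ring.
have d2 : 0 <= dot (k - z) (x2 - k).
  by apply: (vertex 0 0 1); rewrite ?addr0 ?add0r//; ring.
have dotE (c v : R[i]) :
    w0 * dot c (x0 - v) + w1 * dot c (x1 - v) + w2 * dot c (x2 - v) = dot c (k - v).
  have -> : w0 = 1 - w1 - w2 by lra.
  rewrite kE; have -> : w0 = 1 - w1 - w2 by lra.
  by case: (x0) (x1) (x2) (c) (v) => [? ?] [? ?] [? ?] [? ?] [? ?]; rewrite /dot /=; ring.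
have dot0 (c v : R[i]) : dot c (v - v) = 0 by rewrite subrr /dot /=; ring.
have tan_sum := dotE (k - z) k; rewrite dot0 in tan_sum.
have m0 := mulr_ge0 w00 d0; have m1 := mulr_ge0 w10 d1; have m2 := mulr_ge0 w20 d2.
have on_line (w : R) v : 0 < w -> w * dot (k - z) (v - k) = 0 ->
    dot (k - z) (v - k) = 0.
  by move=> w_gt0 /eqP; rewrite mulf_eq0 gt_eqF// => /eqP.
(* [iu] is k - z turned by a right angle, a coordinate along the line that carries the vertices of
   positive weight; [a] and [b] are such vertices on either side of k. *)
pose iu := (- complex.Im (k - z)) +i* complex.Re (k - z).
have iu_sum := dotE iu k; rewrite dot0 in iu_sum.
have [a [Sa au ai]] : exists a, [/\ S a, dot (k - z) (a - k) = 0 & 0 <= dot iu (a - k)].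
  case: (weighted_mean0_ge0 w00 w10 w20 wE iu_sum) => -[wi si].
  - by exists x0; split => //; apply: (on_line _ _ wi); lra.
  - by exists x1; split => //; apply: (on_line _ _ wi); lra.
  - by exists x2; split => //; apply: (on_line _ _ wi); lra.
have [b [Sb bu bi]] : exists b, [/\ S b, dot (k - z) (b - k) = 0 & dot iu (b - k) <= 0].
  have iu_sumN : w0 * - dot iu (x0 - k) + w1 * - dot iu (x1 - k)
    + w2 * - dot iu (x2 - k) = 0 by lra.
  case: (weighted_mean0_ge0 w00 w10 w20 wE iu_sumN) => -[wi si].
  - by exists x0; split; [| apply: (on_line _ _ wi) |]; rewrite -?oppr_ge0//; lra.
  - by exists x1; split; [| apply: (on_line _ _ wi) |]; rewrite -?oppr_ge0//; lra.
  - by exists x2; split; [| apply: (on_line _ _ wi) |]; rewrite -?oppr_ge0//; lra.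
have [r r01 kab] : exists2 r : R, 0 <= r <= 1 & k = (1 - r)%:C * a + r%:C * b.
  have [ab|abN] := eqVneq (dot iu (a - k) - dot iu (b - k)) 0.
    exists 0; rewrite ?lexx ?ler01//.
    have ai0 : dot iu (a - k) = 0 by lra.
    apply/eqP; rewrite subr0 mul1r mul0r addr0 eq_sym -subr_eq0.
    move: au ai0 u0; rewrite /iu; case: (a - k) (k - z) => [p q] [g h].
    rewrite /dot /= eq_complex /= => e1 e2 gh.
    have gh0 : g * g + h * h != 0 by rewrite gt_eqF.
    (* A vector is recovered, up to the factor |k - z|^2, from its components along k - z and
       [iu]. *)
    apply/andP; split; apply/eqP; apply: (mulfI gh0); rewrite mulr0.
      transitivity (g * (g * p + h * q) - h * (- h * p + g * q)); first ring.
      by rewrite e1 e2; ring.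
    transitivity (h * (g * p + h * q) + g * (- h * p + g * q)); first ring.
    by rewrite e1 e2; ring.
  have ab0 : 0 < dot iu (a - k) - dot iu (b - k) by rewrite lt0r abN /=; lra.
  exists (dot iu (a - k) / (dot iu (a - k) - dot iu (b - k))).
    by rewrite divr_ge0 ?(ltW ab0)//= ler_pdivrMr// mul1r; lra.
  set r := _ / _; have rE : r * (dot iu (a - k) - dot iu (b - k)) = dot iu (a - k).
    by rewrite divfK.
  apply/eqP; rewrite eq_sym -subr_eq0.
  have -> : (1 - r)%:C * a + r%:C * b - k = (a - k) + r%:C * ((b - k) - (a - k)).
    by rewrite rmorphB /=; ring.
  move: au bu rE u0; clear; rewrite /iu; case: (a - k) (b - k) (k - z) => [p q] [p' q'] [g h].
  rewrite /dot /= eq_complex /= => e1 e2 rE gh.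
  have gh0 : g * g + h * h != 0 by rewrite gt_eqF.
  apply/andP; split; apply/eqP; apply: (mulfI gh0); rewrite mulr0.
    transitivity ((1 - r) * g * (g * p + h * q) + r * g * (g * p' + h * q')
      - h * ((- h * p + g * q) - r * ((- h * p + g * q) - (- h * p' + g * q')))); first ring.
    by rewrite e1 e2 rE; ring.
  transitivity ((1 - r) * h * (g * p + h * q) + r * h * (g * p' + h * q')
      + g * ((- h * p + g * q) - r * ((- h * p + g * q) - (- h * p' + g * q')))); first ring.
  by rewrite e1 e2 rE; ring.
(* As k lies on [a, b], the segment from k to y lies in the triangle y, a, b; the first parameter is
   the weight of the side [a, b], hence 1 - q. *)
apply: seg => q /andP[q0 q1]; exists (1 - q), r, y, a, b.
split => //; first by apply/andP; split; lra.
by rewrite /triangle_point -kab opprB addrCA subrr addr0 addrC.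
Qed.

(** * Moments and the inner product on polynomials *)

(** Common source of the lower estimates below: growth of the moments, positivity of <p, p>,
    half-planes and peaks. [N] is empty or the complement of the support, [B] empty or a ball around
    a point of the support. *)
Lemma Rintegral_lower_bound (d : measure_display) (T : measurableType d)
  (R : realType) (mu : {measure set T -> \bar R}) (N B : set T) (f : T -> R)
  (a b : R) :
  mu.-integrable setT (fun=> 1%E) -> measurable N -> mu N = 0 -> measurable B ->
  mu.-integrable setT (EFin \o f) ->
  (forall z, ~ N z -> a * \1_B z + b <= f z) ->
  a * fine (mu B) + b * fine (mu setT) <= Rintegral mu setT f.
Proof.
move=> i1 mN N0 mB fi le_f.
have iB : mu.-integrable setT (EFin \o (\1_B : T -> R)).
  apply: (le_integrable measurableT _ _ i1).
    by apply/measurable_EFinP; exact: measurable_indic.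
  move=> x _; rewrite /= !lee_fin ger0_norm ?indicE// ger0_norm//.
  by case: (_ \in _).
have iaB : mu.-integrable setT (EFin \o (fun z => a * (\1_B : T -> R) z)).
  exact: (integrableZl measurableT a iB).
have ib : mu.-integrable setT (EFin \o (fun=> b) : T -> \bar R).
  have := integrableZl measurableT b i1.
  by apply: eq_integrable => // x _ /=; rewrite mule1.
have iD : mu.-integrable setT (EFin \o (fun z => a * (\1_B : T -> R) z + b)).
  exact: (integrableD measurableT iaB ib).
have -> : a * fine (mu B) + b * fine (mu setT) =
    Rintegral mu setT (fun z => a * (\1_B : T -> R) z + b).
  rewrite RintegralD// RintegralZl// Rintegral_cst//; congr (_ * _ + _).
  by rewrite /Rintegral integral_indic// setIT.
rewrite /Rintegral (negligible_integral mN measurableT iD N0).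
rewrite (negligible_integral mN measurableT fi N0).
have mTN : measurable (setT `\` N) by exact: measurableD.
apply: le_Rintegral => //.
- exact: integrableS iD.
- exact: integrableS fi.
- by move=> x [_ Nx]; exact: le_f.
Qed.

Definition cintegrable {R : realType} (mu : {measure set (R * R)%type -> \bar R})
    (g : R * R -> R[i]) :=
  mu.-integrable setT (EFin \o (fun p => complex.Re (g p))) /\
  mu.-integrable setT (EFin \o (fun p => complex.Im (g p))).

Lemma cintegrable_lincomb (R : realType) (mu : {measure set (R * R)%type -> \bar R})
  (c : R[i]) (g h : R * R -> R[i]) :
  cintegrable mu g -> cintegrable mu h -> cintegrable mu (fun p => c * g p + h p).
Proof.
move=> [gr gi] [hr hi]; split.
  have := integrableD measurableT (integrableD measurableT
    (integrableZl measurableT (complex.Re c) gr)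
    (integrableZl measurableT (- complex.Im c) gi)) hr.
  apply: eq_integrable => // p _ /=; case: c (g p) (h p) => [? ?] [? ?] [? ?] /=.
  by rewrite -!EFinM -!EFinD mulNr.
have := integrableD measurableT (integrableD measurableT
  (integrableZl measurableT (complex.Re c) gi)
  (integrableZl measurableT (complex.Im c) gr)) hi.
apply: eq_integrable => // p _ /=; case: c (g p) (h p) => [? ?] [? ?] [? ?] /=.
by rewrite -!EFinM -!EFinD.
Qed.

Lemma cintegral_lincomb (R : realType) (mu : {measure set (R * R)%type -> \bar R})
  (c : R[i]) (g h : R * R -> R[i]) :
  cintegrable mu g -> cintegrable mu h ->
  cintegral mu (fun p => c * g p + h p) = c * cintegral mu g + cintegral mu h.
Proof.
move=> [gr gi] [hr hi].
have Z a f : mu.-integrable setT (EFin \o f) ->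
    mu.-integrable setT (EFin \o (fun p => a * f p)).
  by move=> fi; exact: (integrableZl measurableT a fi).
have D f1 f2 : mu.-integrable setT (EFin \o f1) -> mu.-integrable setT (EFin \o f2) ->
    mu.-integrable setT (EFin \o (fun p => f1 p + f2 p)).
  by move=> i1 i2; exact: (integrableD measurableT i1 i2).
apply/eqP; rewrite eq_complex; apply/andP; split; apply/eqP.
  transitivity (Rintegral mu setT (fun p => complex.Re c * complex.Re (g p)
      + (- complex.Im c) * complex.Im (g p) + complex.Re (h p))).
    by apply: eq_Rintegral => p _; case: c (g p) (h p) => [? ?] [? ?] [? ?] /=; ring.
  rewrite !RintegralD//; [|exact: Z|exact: Z|apply: D; exact: Z].
  rewrite !RintegralZl//.
  by case: c => [? ?] /=; ring.
transitivity (Rintegral mu setT (fun p => complex.Re c * complex.Im (g p)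
    + complex.Im c * complex.Re (g p) + complex.Im (h p))).
  by apply: eq_Rintegral => p _; case: c (g p) (h p) => [? ?] [? ?] [? ?] /=; ring.
rewrite !RintegralD//; [|exact: Z|exact: Z|apply: D; exact: Z].
rewrite !RintegralZl//.
by case: c => [? ?] /=; ring.
Qed.

Lemma cintegrable0 (R : realType) (mu : {measure set (R * R)%type -> \bar R}) :
  cintegrable mu (fun=> 0).
Proof. by split; exact: integrable0. Qed.

Lemma cintegral0 (R : realType) (mu : {measure set (R * R)%type -> \bar R}) :
  cintegral mu (fun=> 0) = 0.
Proof.
by rewrite /cintegral Rintegral_cst//= mul0r.
Qed.

Lemma cintegrable_sum (R : realType) (mu : {measure set (R * R)%type -> \bar R})
  (I : Type) (r : seq I) (c : I -> R[i]) (g : I -> R * R -> R[i]) :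
  (forall i, cintegrable mu (g i)) ->
  cintegrable mu (fun p => \sum_(i <- r) c i * g i p).
Proof.
move=> gi; elim: r => [|i r IH].
  have -> : (fun p => \sum_(i <- [::]) c i * g i p) = (fun=> 0).
    by apply/funext => p; rewrite big_nil.
  exact: cintegrable0.
have -> : (fun p => \sum_(j <- i :: r) c j * g j p) =
    (fun p => c i * g i p + \sum_(j <- r) c j * g j p).
  by apply/funext => p; rewrite big_cons.
exact: cintegrable_lincomb.
Qed.

Lemma cintegral_sum (R : realType) (mu : {measure set (R * R)%type -> \bar R})
  (I : Type) (r : seq I) (c : I -> R[i]) (g : I -> R * R -> R[i]) :
  (forall i, cintegrable mu (g i)) ->
  cintegral mu (fun p => \sum_(i <- r) c i * g i p) =
  \sum_(i <- r) c i * cintegral mu (g i).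
Proof.
move=> gi; elim: r => [|i r IH].
  have -> : (fun p => \sum_(i <- [::]) c i * g i p) = (fun=> 0).
    by apply/funext => p; rewrite big_nil.
  by rewrite cintegral0 big_nil.
have -> : (fun p => \sum_(j <- i :: r) c j * g j p) =
    (fun p => c i * g i p + \sum_(j <- r) c j * g j p).
  by apply/funext => p; rewrite big_cons.
rewrite cintegral_lincomb ?big_cons ?IH//; exact: cintegrable_sum.
Qed.

Lemma measurable_monomial (R : realType) (i j : nat) :
  measurable_fun setT (fun p : R * R => complex.Re (toC p ^+ i * conjc (toC p) ^+ j)) /\
  measurable_fun setT (fun p : R * R => complex.Im (toC p ^+ i * conjc (toC p) ^+ j)).
Proof.
pose mC (g : R * R -> R[i]) := measurable_fun setT (fun p => complex.Re (g p)) /\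
  measurable_fun setT (fun p => complex.Im (g p)).
have mM g h : mC g -> mC h -> mC (fun p => g p * h p).
  move=> [gr gi] [hr hi]; split.
    apply: (eq_measurable_fun (fun p => complex.Re (g p) * complex.Re (h p)
        - complex.Im (g p) * complex.Im (h p))).
      by move=> p _; case: (g p) (h p) => [? ?] [? ?].
    by apply: measurable_funB; exact: measurable_funM.
  apply: (eq_measurable_fun (fun p => complex.Re (g p) * complex.Im (h p)
      + complex.Im (g p) * complex.Re (h p))).
    by move=> p _; case: (g p) (h p) => [? ?] [? ?].
  by apply: measurable_funD; exact: measurable_funM.
have mX g k : mC g -> mC (fun p => g p ^+ k).
  move=> mg; elim: k => [|k IH]; first by split; exact: measurable_cst.
  have -> : (fun p => g p ^+ k.+1) = (fun p => g p * g p ^+ k).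
    by apply/funext => p; rewrite exprS.
  exact: mM.
have m1 : measurable_fun setT (fun p : R * R => p.1) by exact: measurable_fst.
have m2 : measurable_fun setT (fun p : R * R => p.2) by exact: measurable_snd.
apply: mM; apply: mX; split => //.
exact: measurable_funN.
Qed.

(** Both parts are dominated by the modulus, which is |z|^(i + j). *)
Lemma cintegrable_monomial (R : realType) (mu : {measure set (R * R)%type -> \bar R})
  (i j : nat) : finite_moments mu ->
  cintegrable mu (fun p => toC p ^+ i * conjc (toC p) ^+ j).
Proof.
move=> fm; have [mr mi] := measurable_monomial R i j.
have Hn p : `|toC p ^+ i * conjc (toC p) ^+ j| = `|toC p| ^+ (i + j) :> R[i].
  rewrite normrM !normrX exprD; congr (_ * _ ^+ j).
  by rewrite !normc_def /= sqrrN.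
have bound (z : R[i]) : `|complex.Re z| <= complex.Re `|z| /\ `|complex.Im z| <= complex.Re `|z|.
  case: z => a b /=; split; rewrite -sqrtr_sqr ler_sqrt ?addr_ge0 ?sqr_ge0//.
    by rewrite lerDl sqr_ge0.
  by rewrite lerDr sqr_ge0.
have n0 (z : R[i]) : 0 <= complex.Re `|z| by case: z => a b /=; exact: sqrtr_ge0.
split; apply: (le_integrable measurableT _ _ (fm (i + j))).
- exact/measurable_EFinP.
- move=> p _ /=; rewrite lee_fin -Hn [leRHS]ger0_norm//; exact: (bound _).1.
- exact/measurable_EFinP.
- move=> p _ /=; rewrite lee_fin -Hn [leRHS]ger0_norm//; exact: (bound _).2.
Qed.

Definition inner {R : realType} (mu : {measure set (R * R)%type -> \bar R})
    (p q : {poly R[i]}) : R[i] :=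
  cintegral mu (fun z => p.[toC z] * conjc q.[toC z]).

Lemma cintegrable_poly (R : realType) (mu : {measure set (R * R)%type -> \bar R})
  (p q : {poly R[i]}) : finite_moments mu ->
  cintegrable mu (fun z => p.[toC z] * conjc q.[toC z]).
Proof.
move=> fm.
have -> : (fun z : R * R => p.[toC z] * conjc q.[toC z]) =
    (fun z => \sum_(i < size p) p`_i *
      (\sum_(j < size q) conjc q`_j * (toC z ^+ i * conjc (toC z) ^+ j))).
  apply/funext => z; rewrite !horner_coef rmorph_sum mulr_suml; apply: eq_bigr => i _.
  rewrite -mulrA; congr (_ * _); rewrite mulr_sumr; apply: eq_bigr => j _.
  by rewrite rmorphM rmorphXn /=; ring.
apply: cintegrable_sum => i; apply: cintegrable_sum => j.
exact: cintegrable_monomial.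
Qed.

Lemma innerDZl (R : realType) (mu : {measure set (R * R)%type -> \bar R})
  (a : R[i]) (x y z : {poly R[i]}) : finite_moments mu ->
  inner mu (a *: x + y) z = a * inner mu x z + inner mu y z.
Proof.
move=> fm; rewrite /inner -cintegral_lincomb; try exact: cintegrable_poly.
by congr cintegral; apply/funext => t; rewrite hornerD hornerZ mulrDl mulrA.
Qed.

Lemma innerC (R : realType) (mu : {measure set (R * R)%type -> \bar R})
  (x y : {poly R[i]}) : finite_moments mu ->
  inner mu y x = conjc (inner mu x y).
Proof.
move=> fm; rewrite /inner /cintegral /=; congr (_ +i* _).
  by apply: eq_Rintegral => t _; case: _.[_] _.[_] => [a b] [c d] /=; ring.
have [_ i2] := cintegrable_poly x y fm.
rewrite -mulN1r -RintegralZl//.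
by apply: eq_Rintegral => t _; case: _.[_] _.[_] => [a b] [c d] /=; ring.
Qed.

Lemma innerDZr (R : realType) (mu : {measure set (R * R)%type -> \bar R})
  (a : R[i]) (x y z : {poly R[i]}) : finite_moments mu ->
  inner mu z (a *: x + y) = conjc a * inner mu z x + inner mu z y.
Proof.
move=> fm; rewrite innerC// innerDZl// rmorphD rmorphM /=.
by rewrite (innerC x z)// (innerC y z).
Qed.

(* In [moment] and [qform], [^*] is parsed as [Num.conj]; it is convertible to
   [conjc]. *)
Lemma qform_inner (R : realType) (mu : {measure set (R * R)%type -> \bar R})
  (k N : nat) (v : nat -> R[i]) : finite_moments mu ->
  qform (fun i j => moment mu (i + k) j) N v =
  inner mu ('X^k * \poly_(i < N) v i) (\poly_(i < N) v i).
Proof.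
move=> fm; rewrite /inner.
have -> : (fun z : R * R => ('X^k * \poly_(i < N) v i).[toC z] *
      conjc (\poly_(i < N) v i).[toC z]) =
    (fun z => \sum_(i < N) v i *
      (\sum_(j < N) conjc (v j) * (toC z ^+ (i + k) * conjc (toC z) ^+ j))).
  apply/funext => z; rewrite hornerM hornerXn !horner_poly rmorph_sum.
  rewrite -mulrA mulr_suml mulr_sumr; apply: eq_bigr => i _.
  rewrite !mulr_sumr; apply: eq_bigr => j _.
  by rewrite exprD rmorphM rmorphXn /=; ring.
rewrite cintegral_sum; last first.
  by move=> i; apply: cintegrable_sum => j; exact: cintegrable_monomial.
apply: eq_bigr => i _; rewrite cintegral_sum; last first.
  by move=> j; exact: cintegrable_monomial.
rewrite mulr_sumr; apply: eq_bigr => j _.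
rewrite -mulrA; congr (_ * _); rewrite mulrC; congr (_ * _).
Qed.

(** Coefficients identify nonzero finite sequences with nonzero polynomials, and removing the first
    row of the matrix becomes multiplication by 'X. *)
Lemma moment_num_rangeP (R : realType) (mu : {measure set (R * R)%type -> \bar R}) :
  finite_moments mu ->
  moment_num_range mu =
  [set q | exists2 p, p != 0 & q = inner mu ('X * p) p / inner mu p p].
Proof.
move=> fm; have qE v N :
    qform (fun i j => moment mu i.+1 j) N v / qform (moment mu) N v =
    inner mu ('X * \poly_(i < N) v i) (\poly_(i < N) v i) /
    inner mu (\poly_(i < N) v i) (\poly_(i < N) v i).
  rewrite -['X]expr1 -(qform_inner 1)//; congr (_ / _).
    by congr qform; apply/funext => i; rewrite addn1.
  rewrite -[X in inner mu X _]mul1r -(expr0 'X) -(qform_inner 0)//.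
  by congr qform; apply/funext => i; rewrite addn0.
apply/seteqP; split => q.
  move=> [N [v [vN [[k vk] ->]]]]; exists (\poly_(i < N) v i); last exact: qE.
  apply: contraNneq vk => /(congr1 (fun p : {poly R[i]} => p`_k)).
  rewrite coef_poly coef0; case: ltnP => [_ ->//|kN _].
  by rewrite vN.
move=> [p p0 ->]; exists (size p), (fun i => p`_i); split.
  by move=> k; exact: nth_default.
split; first by exists (size p).-1; rewrite -/(lead_coef p) lead_coef_eq0.
by rewrite qE coefK.
Qed.

(** * The support *)

Lemma sqr_lt_norm (R : realType) (t e : R) : 0 < e -> (t * t < e ^+ 2) = (`|t| < e).
Proof.
move=> e0; rewrite -expr2 -[in LHS](real_normK (num_real t)).
by rewrite ltr_pXn2r ?nnegrE ?(ltW e0).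
Qed.

Lemma norm_lt_dot (R : realType) (z : R[i]) (e : R) : 0 < e ->
  (`|z| < e%:C) = (dot z z < e ^+ 2).
Proof.
move=> e0; rewrite normc_def ltcR /dot -!expr2.
by rewrite -[e in LHS](gtr0_norm e0) -sqrtr_sqr ltr_sqrt// exprn_gt0.
Qed.

Lemma measurable_cball (R : realType) (z : R[i]) (e : R) : 0 < e ->
  measurable [set p : R * R | (`|toC p - z| < e%:C)%R].
Proof.
move=> e0.
have mf : measurable_fun setT (fun p : R * R =>
    (p.1 - complex.Re z) * (p.1 - complex.Re z)
    + (p.2 - complex.Im z) * (p.2 - complex.Im z)).
  have m1 : measurable_fun setT (fun p : R * R => p.1) by exact: measurable_fst.
  have m2 : measurable_fun setT (fun p : R * R => p.2) by exact: measurable_snd.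
  by apply: measurable_funD; apply: measurable_funM; apply: measurable_funB.
have -> : [set p : R * R | (`|toC p - z| < e%:C)%R] =
    setT `&` (fun p : R * R => (p.1 - complex.Re z) * (p.1 - complex.Re z)
    + (p.2 - complex.Im z) * (p.2 - complex.Im z)) @^-1` `]-oo, e ^+ 2[%classic.
  rewrite setTI; apply/seteqP; split => p; rewrite /= norm_lt_dot// in_itv /=;
    by case: z mf => a b _.
exact: mf.
Qed.

(** The Lindelof argument made explicit: the cover consists of the null open rectangles with
    rational corners, and the other codes give the empty set. Openness and countability make the
    support closed and its complement null. *)
Lemma msupp_compl_cover (R : realType) (mu : {measure set (R * R)%type -> \bar R}) :
  exists F : nat -> set (R * R),
    (forall k, [/\ open (F k), measurable (F k) & mu (F k) = 0]) /\
    ~` (toC @^-1` msupp mu) = \bigcup_k F k.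
Proof.
pose rect (q : rat * rat * rat * rat) : set (R * R) :=
  `]ratr q.1.1.1, ratr q.1.1.2[%classic `*` `]ratr q.1.2, ratr q.2[%classic.
pose F k := if unpickle k is Some q then
  if `[< mu (rect q) = 0 >] then rect q else set0 else set0.
have mrect q : measurable (rect q) by apply: measurableX; exact: measurable_itv.
have orect q : open (rect q).
  rewrite openE => -[x y] [xq yq].
  exists (`]ratr q.1.1.1, ratr q.1.1.2[%classic, `]ratr q.1.2, ratr q.2[%classic) => //.
  by split; apply: open_nbhs_nbhs; split => //; exact: interval_open.
exists F; split.
  move=> k; rewrite /F; case: unpickle => [q|]; last first.
    by split; [exact: open0 | exact: measurable0 | exact: measure0].
  case: asboolP => q0; first by split.
  by split; [exact: open0 | exact: measurable0 | exact: measure0].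
apply/seteqP; split => [[x y]|[x y] [k _]].
  move=> Nxy; have [e e0 He] : exists2 e : R, 0 < e &
      mu [set p | (`|toC p - toC (x, y)| < e%:C)%R] = 0.
    apply: contrapT => H; apply: Nxy => e e0.
    rewrite lt0e measure_ge0 andbT; apply/eqP => He; apply: H.
    by exists e.
  (* A rectangle with sides within e / 2 of the centre fits in the ball of radius e, as 2 (e / 2)^2
     < e^2. *)
  have e2 : 0 < e / 2 by rewrite divr_gt0.
  have /rat_in_itvoo[a aa] : x - e / 2 < x by lra.
  have /rat_in_itvoo[b bb] : x < x + e / 2 by lra.
  have /rat_in_itvoo[c cc] : y - e / 2 < y by lra.
  have /rat_in_itvoo[d dd] : y < y + e / 2 by lra.
  move: aa bb cc dd; rewrite !in_itv /= => /andP[a1 a2] /andP[b1 b2] /andP[c1 c2] /andP[d1 d2].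
  exists (pickle (a, b, c, d)); first exact: Logic.I.
  rewrite /F pickleK.
  have -> : `[< mu (rect (a, b, c, d)) = 0 >].
    apply/asboolP/eqP; rewrite eq_le measure_ge0 andbT -He.
    apply: le_measure; rewrite ?inE//; first exact: measurable_cball.
    move=> [x' y'] [] /=; rewrite !in_itv /= => /andP[a3 b3] /andP[c3 d3].
    have hx : (x' - x) * (x' - x) < (e / 2) ^+ 2.
      by rewrite sqr_lt_norm// ltr_norml; apply/andP; split; lra.
    have hy : (y' - y) * (y' - y) < (e / 2) ^+ 2.
      by rewrite sqr_lt_norm// ltr_norml; apply/andP; split; lra.
    rewrite norm_lt_dot// /dot /=.
    have -> : e ^+ 2 = 4 * (e / 2) ^+ 2 by field.
    by have := sqr_ge0 (e / 2); lra.
  by split; rewrite /= in_itv /=; apply/andP.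
rewrite /F; case: unpickle => [q|//]; case: asboolP => [q0|//] xyq Sxy.
have : nbhs (x, y) (rect q) by apply: open_nbhs_nbhs; split.
move=> /nbhs_ballP [e /= e0 He].
have := Sxy _ e0; rewrite lt_neqAle => /andP[/eqP + _]; apply; apply/esym.
apply/eqP; rewrite eq_le measure_ge0 andbT -q0.
apply: le_measure; rewrite ?inE//; first exact: measurable_cball.
move=> [x' y'] /=; rewrite norm_lt_dot// /dot /= => d; apply: He.
split; rewrite /= /ball /= distrC -sqr_lt_norm//; apply: le_lt_trans d.
  by rewrite lerDl -expr2 sqr_ge0.
by rewrite lerDr -expr2 sqr_ge0.
Qed.

Lemma closed_msupp (R : realType) (mu : {measure set (R * R)%type -> \bar R}) :
  closed (toC @^-1` msupp mu).
Proof.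
have [F [HF FE]] := msupp_compl_cover mu.
rewrite -[X in closed X]setCK closedC FE.
by apply: bigcup_open => k _; case: (HF k).
Qed.

Lemma msupp_compl_null (R : realType) (mu : {measure set (R * R)%type -> \bar R}) :
  measurable (~` (toC @^-1` msupp mu)) /\ mu (~` (toC @^-1` msupp mu)) = 0.
Proof.
have [F [HF FE]] := msupp_compl_cover mu; rewrite FE.
have mF : measurable (\bigcup_k F k).
  by apply: bigcup_measurable => k _; case: (HF k).
split=> //; apply: measure_negligible => //; apply: negligible_bigcup => k.
by apply/negligibleP; case: (HF k).
Qed.

Lemma finite_moments_integrable1 (R : realType)
  (mu : {measure set (R * R)%type -> \bar R}) :
  finite_moments mu -> mu.-integrable setT (fun=> 1%E).
Proof.
by move=> fm; have := fm 0; apply: eq_integrable => // p _; rewrite expr0.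
Qed.

Lemma finite_moments_fin (R : realType)
  (mu : {measure set (R * R)%type -> \bar R}) :
  finite_moments mu -> (mu setT < +oo)%E.
Proof.
move=> /finite_moments_integrable1/integrableP[_].
rewrite (_ : (fun x : R * R => `|1|%E) = cst 1%E); last first.
  by apply/funext => x; rewrite /= normr1.
by rewrite integral_cst// mul1e.
Qed.

Lemma fine_measure_gt0 (R : realType) (mu : {measure set (R * R)%type -> \bar R})
  (B : set (R * R)) : finite_moments mu -> measurable B ->
  (0 < mu B)%E -> 0 < fine (mu B).
Proof.
move=> fm mB B0; apply: fine_gt0; rewrite B0 /=.
apply: le_lt_trans (finite_moments_fin fm).
by apply: le_measure; rewrite ?inE.
Qed.

(** * Growth of the moments and compactness of the support *)

Lemma dot_ge0 (R : realType) (z : R[i]) : 0 <= dot z z.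
Proof. by rewrite addr_ge0// -expr2 sqr_ge0. Qed.

Lemma dotM (R : realType) (x y : R[i]) : dot (x * y) (x * y) = dot x x * dot y y.
Proof. by case: x y => [? ?] [? ?]; rewrite /dot /=; ring. Qed.

Lemma dotX (R : realType) (x : R[i]) (n : nat) : dot (x ^+ n) (x ^+ n) = dot x x ^+ n.
Proof.
elim: n => [|n IH]; first by rewrite /dot /=; ring.
by rewrite !exprS dotM IH.
Qed.

(** The slack is |2 a - b|^2. This stands in for the triangle inequality on squared moduli. *)
Lemma dot_le_double (R : realType) (a b : R[i]) :
  dot b b <= 2 * dot a a + 2 * dot (b - a) (b - a).
Proof.
rewrite -subr_ge0.
have -> : 2 * dot a a + 2 * dot (b - a) (b - a) - dot b b =
    dot (2 * a - b) (2 * a - b).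
  by case: a b => [? ?] [? ?]; rewrite /dot /=; ring.
exact: dot_ge0.
Qed.

Lemma near_exp_le (R : realType) (K A r s : R) : 0 < r -> r < s -> 0 < A ->
  \forall n \near \oo, K * r ^+ n <= A * s ^+ n.
Proof.
move=> r0 rs A0; have s0 : 0 < s by exact: lt_trans rs.
have q1 : `|r / s| < 1.
  by rewrite ger0_norm ?divr_ge0 ?(ltW r0) ?(ltW s0)// ltr_pdivrMr// mul1r.
have := cvg_expr q1 => /cvgrPdist_lt /(_ (A / (`|K| + 1))).
rewrite divr_gt0 ?ltr_wpDl// => /(_ isT); apply: filterS => n.
rewrite sub0r normrN ger0_norm ?exprn_ge0 ?divr_ge0 ?(ltW r0) ?(ltW s0)//.
rewrite ltr_pdivlMr ?ltr_wpDl// exprMn exprVn => h.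
have sn : 0 < s ^+ n by rewrite exprn_gt0.
have rn : 0 < r ^+ n by rewrite exprn_gt0.
apply: (@le_trans _ _ ((`|K| + 1) * r ^+ n)).
  by rewrite ler_pM2r//; apply: le_trans (ler_norm _) _; rewrite lerDl.
rewrite -ler_pdivrMr//; apply: ltW; apply: le_lt_trans h.
by rewrite -mulrA mulrC.
Qed.

Lemma conjcX (R : realType) (z : R[i]) (n : nat) : conjc (z ^+ n) = conjc z ^+ n.
Proof. exact: rmorphXn. Qed.

Lemma moment_diag (R : realType) (mu : {measure set (R * R)%type -> \bar R})
  (n : nat) :
  complex.Re (moment mu n n) = Rintegral mu setT (fun p => dot (toC p) (toC p) ^+ n).
Proof.
apply: eq_Rintegral => p _; rewrite -dotX.
rewrite -[LHS]/(complex.Re (toC p ^+ n * conjc (toC p) ^+ n)) -conjcX.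
by case: (_ ^+ n) => a b; rewrite /dot /=; ring.
Qed.

Lemma integrable_dot_exp (R : realType) (mu : {measure set (R * R)%type -> \bar R})
  (n : nat) : finite_moments mu ->
  mu.-integrable setT (EFin \o (fun p => dot (toC p) (toC p) ^+ n)).
Proof.
move=> fm; have [+ _] := cintegrable_monomial n n fm.
apply: eq_integrable => // p _; congr EFin; rewrite -dotX -conjcX.
by case: (_ ^+ n) => a b; rewrite /dot /=; ring.
Qed.

(** A distant point of the support puts a mass m > 0 where |z| >= M + 1, so c_{n,n} >= m (M +
    1)^(2n), while the roots c_{n,n}^{1/(2n)} are eventually at most M. *)
Lemma msupp_bounded (R : realType) (mu : {measure set (R * R)%type -> \bar R}) :
  finite_moments mu ->
  (exists L : R, (fun n : nat => complex.Re (moment mu n n) `^ (n.*2%:R)^-1)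
                    @ \oo --> L) ->
  exists D, forall z, msupp mu z -> dot z z <= D.
Proof.
move=> fm [L cL]; pose M := `|L| + 1.
have LM : L < M by apply: le_lt_trans (ler_norm _) _; rewrite ltrDl.
have M0 : 0 < M by rewrite ltr_wpDl.
(* By |z0|^2 <= 2 |z|^2 + 2 |z0 - z|^2, this bound is what forces |z| > M + 1 on the whole unit ball
   around z0. *)
exists (2 * ((M + 1) ^+ 2 + 1)) => z0 Sz0; rewrite leNgt; apply/negP => Hz0.
have m0 := fine_measure_gt0 fm (measurable_cball z0 ltr01) (Sz0 _ ltr01).
set B := [set p | _] in m0.
have mB : measurable B by exact: measurable_cball.
have rs : M ^+ 2 < (M + 1) ^+ 2 by rewrite ltr_pXn2r ?nnegrE//; lra.
have lower n : fine (mu B) * ((M + 1) ^+ 2) ^+ n <= complex.Re (moment mu n n).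
  rewrite moment_diag.
  have := @Rintegral_lower_bound _ _ _ mu set0 B
    (fun p => dot (toC p) (toC p) ^+ n) (((M + 1) ^+ 2) ^+ n) 0
    (finite_moments_integrable1 fm) measurable0 (measure0 _) mB
    (integrable_dot_exp n fm).
  rewrite mul0r addr0 mulrC; apply => p _; rewrite addr0 indicE.
  have [pB|] := boolP (p \in B); last by rewrite mulr0 exprn_ge0// dot_ge0.
  move: pB; rewrite inE /B /= norm_lt_dot// => pB.
  rewrite mulr1 lerXn2r ?nnegrE ?dot_ge0 ?sqr_ge0//.
  have := dot_le_double (toC p) z0.
  have -> : dot (z0 - toC p) (z0 - toC p) = dot (toC p - z0) (toC p - z0).
    by case: (z0) => ? ?; rewrite /dot /=; ring.
  by move: pB Hz0; lra.
(* The factor 2 makes the final contradiction strict. *)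
have near1 : \forall n \near \oo, 2 * (M ^+ 2) ^+ n <= fine (mu B) * ((M + 1) ^+ 2) ^+ n.
  by apply: near_exp_le => //; rewrite exprn_gt0.
have near2 : \forall n \near \oo, complex.Re (moment mu n n) `^ (n.*2%:R)^-1 <= M.
  exact: (cvgr_le _ cL _ LM).
near \oo => n.
have n1 : (0 < n)%N by near: n; exists 1%N.
have h1 : 2 * (M ^+ 2) ^+ n <= fine (mu B) * ((M + 1) ^+ 2) ^+ n by near: n; exact: near1.
have h2 : complex.Re (moment mu n n) `^ (n.*2%:R)^-1 <= M by near: n; exact: near2.
have c0 : 0 <= complex.Re (moment mu n n).
  by apply: le_trans (lower n); rewrite mulr_ge0 ?(ltW m0)// exprn_ge0// sqr_ge0.
have h3 : complex.Re (moment mu n n) <= (M ^+ 2) ^+ n.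
  have -> : complex.Re (moment mu n n) =
      (complex.Re (moment mu n n) `^ (n.*2%:R)^-1) ^+ n.*2.
    rewrite -powR_mulrn ?powR_ge0// -powRrM mulVf ?powRr1//.
    by rewrite pnatr_eq0 double_eq0 -lt0n.
  rewrite -exprM mul2n lerXn2r ?nnegrE ?powR_ge0// ltW//.
have : 0 < (M ^+ 2) ^+ n by rewrite !exprn_gt0.
have := lower n; lra.
Unshelve. all: by end_near.
Qed.

Lemma compact_msupp (R : realType) (mu : {measure set (R * R)%type -> \bar R})
  (D : R) : (forall z, msupp mu z -> dot z z <= D) ->
  compact (toC @^-1` msupp mu).
Proof.
move=> bD.
(* The half-side [D + 1] avoids a square root, since |x| <= x^2 + 1. *)
apply: (@subclosed_compact _ _
  (`[- (D + 1), D + 1]%classic `*` `[- (D + 1), D + 1]%classic)).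
- exact: closed_msupp.
- by apply: compact_setX; exact: segment_compact.
move=> [x y] /bD; rewrite /dot /= => xyD.
have := sqr_ge0 x; have := sqr_ge0 y; rewrite !expr2 => y2 x2.
have := sqr_ge0 (x - 1); have := sqr_ge0 (x + 1).
have := sqr_ge0 (y - 1); have := sqr_ge0 (y + 1); rewrite !expr2 => *.
by split; rewrite /= in_itv /=; apply/andP; split; nra.
Qed.

(** The polynomial splits into linear factors, and near z0 each |x - a|^2 keeps at least a quarter
    of |z0 - a|^2. *)
Lemma poly_norm_lower_bound (R : realType) (p : {poly R[i]}) (z0 : R[i]) :
  p.[z0] != 0 -> exists e c : R, [/\ 0 < e, 0 < c &
    forall x, `|x - z0| < e%:C -> c <= dot p.[x] p.[x]].
Proof.
have dot_gt0 (v : R[i]) : v != 0 -> 0 < dot v v.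
  rewrite lt0r dot_ge0 andbT; apply: contra_neq; case: v => a b.
  rewrite /dot /= -!expr2 => /eqP.
  by rewrite paddr_eq0 ?sqr_ge0// !sqrf_eq0 => /andP[/eqP-> /eqP->].
have [r ->] := closed_field_poly_normal p.
rewrite hornerZ mulf_eq0 negb_or => /andP[l0 pr0].
suff [e [c [e0 c0 H]]] : exists e c : R, [/\ 0 < e, 0 < c &
    forall x, `|x - z0| < e%:C ->
    c <= dot (\prod_(z <- r) ('X - z%:P)).[x] (\prod_(z <- r) ('X - z%:P)).[x]].
  exists e, (dot (lead_coef p) (lead_coef p) * c); split=> //.
    by rewrite mulr_gt0// dot_gt0.
  by move=> x /H; rewrite hornerZ dotM ler_pM2l// dot_gt0.
elim: r pr0 => [|a r IH] pr0.
  exists 1, 1; split => // x _; rewrite big_nil hornerC /dot /=.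
  by rewrite mulr1 mulr0 addr0.
move: pr0; rewrite big_cons hornerM mulf_eq0 negb_or hornerXsubC => /andP[za pr0].
have [e [c [e0 c0 H]]] := IH pr0.
have d0 := dot_gt0 _ za; set d := dot _ _ in d0.
exists (Num.min e (Num.min 1 (d / 4))), (d / 4 * c).
have e'0 : 0 < Num.min e (Num.min 1 (d / 4)) by rewrite !lt_min e0 ltr01 divr_gt0.
split; rewrite ?mulr_gt0 ?divr_gt0// => x.
move=> xz; rewrite hornerM dotM hornerXsubC ler_pM ?(ltW c0) ?divr_ge0 ?(ltW d0)//; last first.
  by apply: H; apply: lt_le_trans xz _; rewrite lecR ge_min lexx.
move: xz; rewrite norm_lt_dot//.
set e' := Num.min e _ in e'0 * => xz.
have e'1 : e' <= 1 by rewrite /e' !ge_min lexx orbT.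
have e'd : e' <= d / 4 by rewrite /e' !ge_min lexx !orbT.
have := dot_le_double (x - a) (z0 - a); rewrite -/d.
have -> : dot (z0 - a - (x - a)) (z0 - a - (x - a)) = dot (x - z0) (x - z0).
  by case: (z0) (x) (a) => [? ?] [? ?] [? ?]; rewrite /dot /=; ring.
have : e' ^+ 2 <= e' by rewrite expr2 ger_pMr.
by lra.
Qed.

(** The finitely many roots of p cannot exhaust an infinite support, and |p|^2 is bounded below on a
    ball of positive mass around a remaining point. *)
Lemma inner_gt0 (R : realType) (mu : {measure set (R * R)%type -> \bar R})
  (p : {poly R[i]}) : finite_moments mu -> infinite_set (msupp mu) ->
  p != 0 -> 0 < complex.Re (inner mu p p).
Proof.
move=> fm infS p0.
have [z0 Sz0 pz0] : exists2 z, msupp mu z & p.[z] != 0.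
  apply: contrapT => H; apply: infS.
  have [r pE] := closed_field_poly_normal p.
  apply: (@sub_finite_set _ _ [set` r]); last exact: finite_seq.
  move=> z Sz /=; rewrite -root_prod_XsubC.
  apply/rootP/eqP; apply: contrapT => /negP prz; apply: H; exists z => //.
  by rewrite pE hornerZ mulf_neq0// lead_coef_eq0.
have [e [c [e0 c0 H]]] := poly_norm_lower_bound pz0.
have m0 := fine_measure_gt0 fm (measurable_cball z0 e0) (Sz0 _ e0).
apply: (@lt_le_trans _ _ (c * fine (mu [set q | (`|toC q - z0| < e%:C)%R]))).
  by rewrite mulr_gt0.
have [ir _] := cintegrable_poly p p fm.
have := Rintegral_lower_bound (finite_moments_integrable1 fm) measurable0
  (measure0 _) (measurable_cball z0 e0) ir (a := c) (b := 0).
rewrite mul0r addr0; apply => q _; rewrite addr0 indicE.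
have -> : complex.Re (p.[toC q] * conjc p.[toC q]) = dot p.[toC q] p.[toC q].
  by case: _.[_] => ? ?; rewrite /dot /=; ring.
case: (boolP (q \in _)) => [|_]; last by rewrite mulr0 dot_ge0.
by rewrite inE mulr1; exact: H.
Qed.

(** * Rayleigh quotients *)

Lemma inner_real (R : realType) (mu : {measure set (R * R)%type -> \bar R})
  (p : {poly R[i]}) : finite_moments mu ->
  inner mu p p = (complex.Re (inner mu p p))%:C.
Proof.
move=> fm; have := innerC p p fm; case: (inner mu p p) => a b [] /= /eqP.
by rewrite -addr_eq0 -mulr2n -mulr_natl mulf_eq0 pnatr_eq0 /= => /eqP ->.
Qed.

Lemma Rintegral_affine_weight (R : realType)
  (mu : {measure set (R * R)%type -> \bar R}) (u : R[i]) (c : R) (p : {poly R[i]}) :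
  finite_moments mu ->
  let f := fun z : R * R => (dot u (toC z) + c) * dot p.[toC z] p.[toC z] in
  mu.-integrable setT (EFin \o f) /\
  Rintegral mu setT f = dot u (inner mu ('X * p) p) + c * complex.Re (inner mu p p).
Proof.
move=> fm f.
have [r1 i1] := cintegrable_poly ('X * p) p fm.
have [r2 _] := cintegrable_poly p p fm.
have Z a g : mu.-integrable setT (EFin \o g) ->
    mu.-integrable setT (EFin \o (fun p => a * g p)).
  by move=> gi; exact: (integrableZl measurableT a gi).
have DD g1 g2 : mu.-integrable setT (EFin \o g1) -> mu.-integrable setT (EFin \o g2) ->
    mu.-integrable setT (EFin \o (fun p => g1 p + g2 p)).
  by move=> j1 j2; exact: (integrableD measurableT j1 j2).
have -> : f = fun z => complex.Re u * complex.Re (('X * p).[toC z] * conjc p.[toC z])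
    + complex.Im u * complex.Im (('X * p).[toC z] * conjc p.[toC z])
    + c * complex.Re (p.[toC z] * conjc p.[toC z]).
  apply/funext => z; rewrite /f hornerM hornerX.
  by case: (p.[_]) (u) => [? ?] [? ?]; rewrite /dot /=; ring.
split; first by apply: (DD _ _ (DD _ _ _ _) _); exact: Z.
rewrite !RintegralD//; [|exact: Z|exact: Z|apply: DD; exact: Z|exact: Z].
by rewrite !RintegralZl.
Qed.

Lemma dotDr (R : realType) (u x y : R[i]) : dot u (x + y) = dot u x + dot u y.
Proof. by case: x y => [? ?] [? ?]; rewrite /dot /=; ring. Qed.

Lemma dotNr (R : realType) (u x : R[i]) : dot u (- x) = - dot u x.
Proof. by case: x => [? ?]; rewrite /dot /=; ring. Qed.

Lemma dotZr (R : realType) (u x : R[i]) (a : R) : dot u (a%:C * x) = a * dot u x.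
Proof. by case: x => [? ?]; rewrite /dot /=; ring. Qed.

(** Turns an affine inequality on the mean into the sign of an integral against the weight |p|^2. *)
Lemma Rintegral_rayleigh (R : realType)
  (mu : {measure set (R * R)%type -> \bar R}) (u : R[i]) (c : R) (p : {poly R[i]}) :
  finite_moments mu -> 0 < complex.Re (inner mu p p) ->
  Rintegral mu setT (fun z => (dot u (toC z) + c) * dot p.[toC z] p.[toC z]) =
  complex.Re (inner mu p p) * (dot u (inner mu ('X * p) p / inner mu p p) + c).
Proof.
move=> fm p0; rewrite (Rintegral_affine_weight u c p fm).2.
rewrite [in X in dot u (_ / X)]inner_real//.
set B := complex.Re _ in p0 *.
rewrite -fmorphV mulrC [_ * (_)%:C]mulrC dotZr.
by field; rewrite gt_eqF.
Qed.

Lemma rayleigh_half_plane (R : realType)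
  (mu : {measure set (R * R)%type -> \bar R}) (u : R[i]) (c : R) (p : {poly R[i]}) :
  finite_moments mu -> 0 < complex.Re (inner mu p p) ->
  (forall z, msupp mu z -> 0 <= dot u z + c) ->
  0 <= dot u (inner mu ('X * p) p / inner mu p p) + c.
Proof.
move=> fm p0 H; rewrite -(pmulr_rge0 _ p0) -Rintegral_rayleigh//.
have [mN N0] := msupp_compl_null mu.
have [fi _] := Rintegral_affine_weight u c p fm.
have := Rintegral_lower_bound (a := 0) (b := 0)
  (finite_moments_integrable1 fm) mN N0 measurable0 fi.
rewrite !mul0r addr0; apply => z /contrapT Sz.
by rewrite mul0r addr0 mulr_ge0 ?dot_ge0//; exact: H.
Qed.

(** Cauchy-Schwarz, with Lagrange's identity giving the slack as a squared determinant. *)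
Lemma dot_sqr_le (R : realType) (u v : R[i]) : dot u v ^+ 2 <= dot u u * dot v v.
Proof.
rewrite -subr_ge0; case: u v => [a b] [c d].
have -> : dot (a +i* b) (a +i* b) * dot (c +i* d) (c +i* d) -
  dot (a +i* b) (c +i* d) ^+ 2 = (a * d - b * c) ^+ 2 by rewrite /dot /=; ring.
exact: sqr_ge0.
Qed.

Lemma dot_small (R : realType) (u : R[i]) (e : R) : 0 < e ->
  exists2 d : R, 0 < d & forall v, dot v v < d ^+ 2 -> `|dot u v| < e.
Proof.
move=> e0; have U0 := dot_ge0 u; set U := dot u u in U0 *.
have U1 : 0 < U + 1 by lra.
exists (e / (U + 1)); first by rewrite divr_gt0.
move=> v vd; rewrite -sqr_lt_norm// -expr2; apply: le_lt_trans (dot_sqr_le u v) _.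
rewrite -/U; apply: (@le_lt_trans _ _ (U * (e / (U + 1)) ^+ 2)).
  by rewrite ler_wpM2l// ltW.
have -> : e ^+ 2 = (U + 1) ^+ 2 * (e / (U + 1)) ^+ 2 by field; rewrite gt_eqF.
rewrite ltr_pM2r ?exprn_gt0 ?divr_gt0//.
by rewrite expr2; nra.
Qed.

Lemma oppr_le_sqrD1 (R : realType) (x : R) : - x <= x ^+ 2 + 1.
Proof.
have := sqr_ge0 (x + 1); have := sqr_ge0 x.
by rewrite sqrrD expr1n mulr1; lra.
Qed.

(* The weights [|z - w|^(2n)] with [w = z0 - T u], [T] large, concentrate on the
   part of the support where [dot u (z - z0)] is not much below 0. *)
Lemma rayleigh_peak (R : realType) (mu : {measure set (R * R)%type -> \bar R})
  (D : R) (z0 u : R[i]) (e : R) :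
  finite_moments mu -> infinite_set (msupp mu) ->
  (forall z, msupp mu z -> dot z z <= D) -> msupp mu z0 -> 0 < e ->
  exists2 p, p != 0 & - e <= dot u (inner mu ('X * p) p / inner mu p p - z0).
Proof.
move=> fm infS bD Sz0 e0.
have D0 : 0 <= D := le_trans (dot_ge0 z0) (bD _ Sz0).
have e4 : 0 < e / 4 by rewrite divr_gt0.
have [r r0 Hr] := dot_small u e4.
(* Bounds the squared diameter of the support; with Cauchy-Schwarz it yields the lower bound - K for
   u.(z - z0) below. *)
pose Q := 4 * D.
have HQ z : msupp mu z -> dot (z - z0) (z - z0) <= Q.
  move=> Sz; have := dot_le_double z (z - z0); have := bD _ Sz; have := bD _ Sz0.
  have -> : dot (z - z0 - z) (z - z0 - z) = dot z0 z0.
    by case: (z) (z0) => [? ?] [? ?]; rewrite /dot /=; ring.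
  by rewrite /Q; lra.
have U0 := dot_ge0 u; set U := dot u u in U0 *.
pose K := U * Q + 1.
have HK z : msupp mu z -> - K <= dot u (z - z0).
  move=> Sz; have := dot_sqr_le u (z - z0); rewrite -/U => h.
  have : U * dot (z - z0) (z - z0) <= U * Q by rewrite ler_wpM2l// HQ.
  by have := oppr_le_sqrD1 (dot u (z - z0)); rewrite /K; lra.
have Q0 : 0 <= Q by rewrite /Q; lra.
have [u0|uN0] := eqVneq U 0.
  exists 1; first exact: oner_neq0.
  have -> v : dot u v = 0.
    have := dot_sqr_le u v; rewrite -/U u0 mul0r => h.
    by apply/eqP; rewrite -sqrf_eq0 eq_le h sqr_ge0.
  by lra.
have {uN0}U_gt0 : 0 < U by rewrite lt0r uN0.
(* The first summand gives Q <= T e, which absorbs |z - z0|^2 at far points; the second gives 2 e <=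
   T U, which makes [rho] positive. *)
pose T := Q / e + 2 * e / U.
have TQ : Q <= T * e.
  have : 0 <= 2 * e / U * e by rewrite !mulr_ge0 ?invr_ge0 ?(ltW e0) ?(ltW U_gt0)//.
  have -> : T * e = Q + 2 * e / U * e by rewrite /T; field; rewrite !gt_eqF.
  by lra.
have TU : 2 * e <= T * U.
  have : 0 <= Q / e * U by rewrite !mulr_ge0 ?invr_ge0 ?(ltW e0) ?(ltW U_gt0)//.
  have -> : T * U = Q / e * U + 2 * e by rewrite /T; field; rewrite !gt_eqF.
  by lra.
have T0 : 0 < T.
  by rewrite -(pmulr_lgt0 _ U_gt0); apply: lt_le_trans TU; rewrite mulr_gt0.
(* [rho] bounds |z - w|^2 from above where u.(z - z0) <= - e, and [sg] bounds it from below near z0,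
   where |u.(z - z0)| < e / 4. *)
pose rho := T ^+ 2 * U - T * e; pose sg := T ^+ 2 * U - T * e / 2.
have Te : 0 < T * e by rewrite mulr_gt0.
have rho0 : 0 < rho.
  have : T * (2 * e) <= T * (T * U) by rewrite ler_pM2l.
  by rewrite /rho expr2; lra.
have rs : rho < sg by rewrite /rho /sg; lra.
pose w := z0 - T%:C * u.
have wE z : dot (z - w) (z - w) =
    dot (z - z0) (z - z0) + 2 * T * dot u (z - z0) + T ^+ 2 * U.
  rewrite /w /U; case: (z) (z0) (u) => [? ?] [? ?] [? ?]; rewrite /dot /=; ring.
have far z : msupp mu z -> dot u (z - z0) <= - e -> dot (z - w) (z - w) <= rho.
  move=> Sz ze; rewrite wE /rho; have := HQ _ Sz.
  have : T * dot u (z - z0) <= T * (- e) by rewrite ler_pM2l.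
  by lra.
have near_z0 z : dot (z - z0) (z - z0) < r ^+ 2 -> sg <= dot (z - w) (z - w).
  move=> /Hr; rewrite ltr_norml => /andP[h _]; rewrite wE /sg.
  have : T * - (e / 4) <= T * dot u (z - z0) by rewrite ler_pM2l// ltW.
  by have := dot_ge0 (z - z0); lra.
have m0 := fine_measure_gt0 fm (measurable_cball z0 r0) (Sz0 _ r0).
set B := [set q | _] in m0.
have mB : measurable B by exact: measurable_cball.
have K0 : 0 < K by rewrite /K ltr_wpDl// mulr_ge0.
have [n Hn] : exists n, K * fine (mu setT) * rho ^+ n <= 3 * e / 4 * fine (mu B) * sg ^+ n.
  have : \forall n \near \oo,
      K * fine (mu setT) * rho ^+ n <= 3 * e / 4 * fine (mu B) * sg ^+ n.
    by apply: near_exp_le => //; rewrite mulr_gt0// divr_gt0// mulr_gt0.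
  by case=> N _ /(_ N (leqnn N)); exists N.
pose p := ('X - w%:P) ^+ n : {poly R[i]}.
have p0 : p != 0 by rewrite expf_neq0// polyXsubC_eq0.
exists p => //.
have Bp := inner_gt0 fm infS p0.
rewrite dotDr dotNr -subr_ge0.
have -> x y : x - y - - e = x + (e - y) :> R by ring.
rewrite -(pmulr_rge0 _ Bp) -Rintegral_rayleigh//.
have [mN N0] := msupp_compl_null mu.
have [fi _] := Rintegral_affine_weight u (e - dot u z0) p fm.
(* The integrand (u.(z - z0) + e) |z - w|^(2n) is at least 3 e / 4 sg^n on the ball, at least - K
   rho^n where u.(z - z0) <= - e, and nonnegative elsewhere on the support. *)
have := Rintegral_lower_bound (a := 3 * e / 4 * sg ^+ n) (b := - (K * rho ^+ n))
  (finite_moments_integrable1 fm) mN N0 mB fi.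
move=> lower; apply: le_trans (lower _); first by lra.
move=> q /contrapT Sq; have {}Sq : msupp mu (toC q) := Sq.
have -> : p.[toC q] = (toC q - w) ^+ n by rewrite /p horner_exp hornerXsubC.
rewrite dotX; set z := toC q in Sq *.
have -> : dot u z + (e - dot u z0) = dot u (z - z0) + e by rewrite dotDr dotNr; ring.
have rn : 0 < rho ^+ n by rewrite exprn_gt0.
have Krn : 0 < K * rho ^+ n by rewrite mulr_gt0.
have Nn : 0 <= dot (z - w) (z - w) ^+ n by rewrite exprn_ge0// dot_ge0.
rewrite indicE; have [qB|_] := boolP (q \in B).
  move: qB; rewrite inE /B /= -/z norm_lt_dot// => qB.
  have h1 : 3 * e / 4 <= dot u (z - z0) + e.
    by have := Hr _ qB; rewrite ltr_norml => /andP[]; lra.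
  have h2 : sg ^+ n <= dot (z - w) (z - w) ^+ n.
    by rewrite lerXn2r ?nnegrE ?dot_ge0// ?near_z0// ltW// (lt_trans rho0).
  have : 3 * e / 4 * sg ^+ n <= (dot u (z - z0) + e) * dot (z - w) (z - w) ^+ n.
    apply: ler_pM => //; first by lra.
    by rewrite exprn_ge0// ltW// (lt_trans rho0).
  by lra.
rewrite mulr0 add0r; have [ze|ze] := leP (dot u (z - z0)) (- e); last first.
  have : 0 <= (dot u (z - z0) + e) * dot (z - w) (z - w) ^+ n.
    by rewrite mulr_ge0//; lra.
  by lra.
have h1 : - K <= dot u (z - z0) + e by have := HK _ Sq; lra.
have h2 : dot (z - w) (z - w) ^+ n <= rho ^+ n.
  by rewrite lerXn2r ?nnegrE ?dot_ge0 ?far// ltW.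
apply: (@le_trans _ _ (- K * dot (z - w) (z - w) ^+ n)).
  by rewrite mulNr lerN2 ler_pM2l.
by rewrite ler_wpM2r.
Qed.

(** * Closure of the set of means and the two inclusions *)

Lemma closure_dotP (R : realType) (W : set R[i]) (z : R[i]) :
  @closure (R[i])^o W z <->
  forall e : R, 0 < e -> exists2 w, W w & dot (z - w) (z - w) < e ^+ 2.
Proof.
split=> [zW e e0|H B /nbhs_ballP[e /= e0 eB]].
  have : nbhs (z : (R[i])^o) (ball (z : (R[i])^o) e%:C).
    by apply: nbhsx_ballx; rewrite ltcR.
  move=> /zW [w [Ww]]; rewrite -ball_normE /= norm_lt_dot// => zw.
  by exists w.
(* Radii in [(R[i])^o] are complex numbers; a positive one is real. *)
have eE : e = (complex.Re e)%:C.
  by move: e0; rewrite ltcE; case: (e) => a b /= /andP[/eqP ->].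
have e0' : 0 < complex.Re e by move: e0; rewrite {1}eE ltcR.
have [w Ww zw] := H _ e0'; exists w; split => //.
by apply: eB; rewrite -ball_normE /= eE norm_lt_dot.
Qed.

Unset Implicit Arguments.

Theorem theorem2 (R : realType) (mu : {measure set (R * R)%type -> \bar R}) :
  finite_moments mu ->
  infinite_set (msupp mu) ->
  (exists L : R, (fun n : nat => complex.Re (moment mu n n) `^ (n.*2%:R)^-1)
                    @ \oo --> L) ->
  @closure (R[i])^o (moment_num_range mu) = conv_hull (msupp mu).
Proof.
move=> fm infS cvgL.
have [D bD] := msupp_bounded fm cvgL.
have pos := inner_gt0 fm infS.
have [s0 Ss0] : msupp mu !=set0.
  by apply/set0P; apply: contra_notN infS => /eqP ->; exact: finite_set0.
have D0 : 0 <= D := le_trans (dot_ge0 s0) (bD _ Ss0).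
rewrite moment_num_rangeP//; set W := [set q | _].
apply/seteqP; split=> z.
  move=> /closure_dotP zW; apply: contrapT => Nz.
  have [u [e [e0 He]]] := sep_conv_hull (compact_msupp bD) (ex_intro _ s0 Ss0) Nz.
  (* A mean w within d of z has u.w < u.z + e, whereas the half-plane containing the support forces
     u.w >= u.z + e. *)
  have [d d0 Hd] := dot_small u e0.
  have [_ [p p0 ->] zw] := zW _ d0.
  have := Hd _ zw; rewrite ltr_norml => /andP[+ _].
  rewrite dotDr dotNr; apply/negP; rewrite -leNgt.
  have := rayleigh_half_plane (u := u) (c := - dot u z - e) fm (pos _ p0).
  have H t : msupp mu t -> 0 <= dot u t + (- dot u z - e).
    by move=> /He; rewrite dotDr dotNr; lra.
  by move=> /(_ H); lra.
move=> [n [l [x [l0 [l1 [Sx ->]]]]]]; set y := \sum_(k < n) _.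
apply: contrapT => Ny.
have [e e0 He] : exists2 e : R, 0 < e & forall w, W w -> e <= dot (y - w) (y - w).
  apply: contrapT => H; apply: Ny; apply/closure_dotP => e e0.
  apply: contrapT => H'; apply: H; exists (e ^+ 2); first by rewrite exprn_gt0.
  by move=> w Ww; rewrite leNgt; apply/negP => h; apply: H'; exists w.
have cvxW a b t : 0 <= t <= 1 -> W a -> W b -> W ((1 - t)%:C * a + t%:C * b).
  move=> t01 [f f0 ->] [g g0 ->].
  have [h h0 hE] := toeplitz_hausdorff (V := {poly R[i]})
    (A := fun p q => inner mu ('X * p) q) (B := inner mu)
    (fun a x y z => etrans (congr1 (fun p => inner mu p z)
       (etrans (mulrDr _ _ _) (congr1 (+%R^~ _) (esym (scalerAr _ _ _)))))
       (innerDZl a _ _ z fm))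
    (fun a x y z => innerDZr a x y _ fm)
    (fun a x y z => innerDZl a x y z fm)
    (fun x y => innerC x y fm) pos f0 g0 t01.
  by exists h.
(* Each coordinate of a mean is bounded by [D + 1], through the half-planes in the directions 1, i
   and their opposites. *)
have bW w : W w -> dot w w <= 2 * (D + 1) ^+ 2.
  move=> [p p0 ->]; set v := _ / _.
  have half c : dot c c = 1 -> `|dot c v| <= D + 1.
    move=> c1; have Hc c' t : dot c' c' = 1 -> msupp mu t -> 0 <= dot c' t + (D + 1).
      move=> c'1 /bD; have := dot_sqr_le c' t; rewrite c'1 mul1r.
      by have := oppr_le_sqrD1 (dot c' t); lra.
    have Nc1 : dot (- c) (- c) = 1.
      by rewrite -c1; case: (c) => ? ?; rewrite /dot /=; ring.
    have hp := rayleigh_half_plane fm (pos _ p0) (fun t => Hc c t c1).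
    have hm := rayleigh_half_plane fm (pos _ p0) (fun t => Hc (- c) t Nc1).
    have : dot (- c) v = - dot c v by case: (c) (v) => [? ?] [? ?]; rewrite /dot /=; ring.
    by rewrite ler_norml; move: hp hm; rewrite -/v => *; apply/andP; split; lra.
  have h1 := half (1 +i* 0) ltac:(rewrite /dot /=; ring).
  have h2 := half (0 +i* 1) ltac:(rewrite /dot /=; ring).
  have sq (t : R) : `|t| <= D + 1 -> t ^+ 2 <= (D + 1) ^+ 2.
    by move=> h; rewrite -(real_normK (num_real t)) lerXn2r ?nnegrE//; lra.
  have := sq _ h1; have := sq _ h2; rewrite /dot /= !mul0r !mul1r addr0 add0r.
  by rewrite -!expr2; lra.
have W0 : exists w, W w by exists (inner mu ('X * 1) 1 / inner mu 1 1), 1; rewrite ?oner_neq0.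
have [u [d [d0 Hd]]] := sep_convex W0 cvxW bW e0 He.
have d2 : 0 < d / 2 by rewrite divr_gt0.
(* Means stay d behind y in the direction u, and some mean comes within d / 2 of [x k]. Averaging
   over k then puts y behind itself. *)
have xk k : dot u (x k) <= dot u y - d / 2.
  have [p p0 hp] := rayleigh_peak u fm infS bD (Sx k) d2.
  have := Hd _ (ex_intro2 _ _ p p0 erefl); move: hp.
  by rewrite !dotDr !dotNr; lra.
have yE : dot u y = \sum_(k < n) l k * dot u (x k).
  rewrite /y (big_morph (dot u) (id1 := 0) (op1 := +%R) (dotDr u)).
    by apply: eq_bigr => k _; rewrite dotZr.
  by rewrite /dot /= !mulr0 addr0.
have : \sum_(k < n) l k * dot u (x k) <= \sum_(k < n) l k * (dot u y - d / 2).
  by apply: ler_sum => k _; apply: ler_wpM2l.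
by rewrite -yE -mulr_suml l1 mul1r; lra.
Qed.
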